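(* Let $n\ge 3$ and let $R$ be a von Neumann regular ring, i.e. for every $x\in R$ there is a $y\in R$ with $xyx=x$. Let $\sigma\in \mathrm{GL}_n(R)$, let $i,j,k,l\in\{1,\dots,n\}$ with $i\neq j$ and $k\neq l$, and let $a,b,c\in R$. Then (i) $t_{kl}(a\sigma_{ij}b)$ is a product of $8$ $\mathrm{E}_n(R)$-conjugates of $\sigma$ and $\sigma^{-1}$, and (ii) $t_{kl}(a(c\sigma_{ii}-\sigma_{jj}c)b)$ is a product of $24$ $\mathrm{E}_n(R)$-conjugates of $\sigma$ and $\sigma^{-1}$.
   Context: Rings are associative with $1\neq 0$, not necessarily commutative. $\mathrm{GL}_n(R)$ is the group of invertible $n\times n$ matrices over $R$; $\sigma_{ij}$ is the $(i,j)$ entry of $\sigma$. For $i\ne j$ and $x\in R$, $t_{ij}(x)=e+xe^{ij}$, where $e$ is the identity matrix and $e^{ij}$ is the matrix with $1$ at position $(i,j)$ and $0$ elsewhere. $\mathrm{E}_n(R)$ is the subgroup of $\mathrm{GL}_n(R)$ generated by all $t_{ij}(x)$ ($i\neq j$, $x\in R$). For $g,h$ in a group, $g^h=h^{-1}gh$. ''A product of $m$ $\mathrm{E}_n(R)$-conjugates of $\sigma$ and $\sigma^{-1}$'' means a product of $m$ factors, each of the form $\sigma^{\xi}$ or $(\sigma^{-1})^{\xi}$ with $\xi\in \mathrm{E}_n(R)$. *)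

(* Defs.v *)
From HB Require Import structures.
From mathcomp Require Import all_boot all_algebra.

Set Implicit Arguments.
Unset Strict Implicit.
Unset Printing Implicit Defensive.

Import GRing.Theory.
Local Open Scope ring_scope.

Definition von_neumann_regular (R : nzRingType) : Prop :=
  forall x : R, exists y : R, x * y * x = x.

Section GeneralLinear.

Variables (R : nzRingType) (n : nat).
Implicit Types (A B : 'M[R]_n) (x y : R) (i j : 'I_n).

(* [unitmx] and [invmx] need a commutative ring, so an element of GL_n(R) is
   stored with its two-sided inverse, which it determines uniquely. *)
Definition mutual_inverse (AB : 'M[R]_n * 'M[R]_n) : bool :=
  (AB.1 *m AB.2 == 1%:M) && (AB.2 *m AB.1 == 1%:M).

Record GL := MkGL { GL_pair : 'M[R]_n * 'M[R]_n; _ : mutual_inverse GL_pair }.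

HB.instance Definition _ := [isSub for GL_pair].
HB.instance Definition _ := [Choice of GL by <:].

Coercion GLmx (g : GL) : 'M[R]_n := (GL_pair g).1.

Lemma GLmx_inj : injective GLmx.
Proof.
case=> [[A B] AB] [[A' B'] AB'] /= eA; apply: val_inj => /=.
rewrite /GLmx /= in eA; subst A'; congr (_, _).
case/andP: AB AB' => /= _ /eqP BA /andP[/= /eqP AB' _].
by rewrite -[B]mulmx1 -AB' mulmxA BA mul1mx.
Qed.

Lemma GL_one_subproof : mutual_inverse (1%:M, 1%:M).
Proof. by rewrite /mutual_inverse /= mulmx1 eqxx. Qed.

Lemma GL_mul_subproof (g h : GL) :
  mutual_inverse ((GL_pair g).1 *m (GL_pair h).1,
                  (GL_pair h).2 *m (GL_pair g).2).
Proof.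
case: g h => [[A B] /= /andP[/= /eqP AB /eqP BA]].
case=> [[C D] /= /andP[/= /eqP CD /eqP DC]]; apply/andP; split=> /=; apply/eqP.
  by rewrite mulmxA -(mulmxA A) CD mulmx1 AB.
by rewrite mulmxA -(mulmxA D) BA mulmx1 DC.
Qed.

Lemma GL_inv_subproof (g : GL) :
  mutual_inverse ((GL_pair g).2, (GL_pair g).1).
Proof. by case: g => [[A B] /= /andP[/= AB BA]]; apply/andP. Qed.

Definition GL_one : GL := MkGL GL_one_subproof.
Definition GL_mul (g h : GL) : GL := MkGL (GL_mul_subproof g h).
Definition GL_inv (g : GL) : GL := MkGL (GL_inv_subproof g).

Lemma GL_mulA : associative GL_mul.
Proof. by move=> g h k; apply: GLmx_inj; rewrite /GLmx /= mulmxA. Qed.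

Lemma GL_mul1 : left_id GL_one GL_mul.
Proof. by move=> g; apply: GLmx_inj; rewrite /GLmx /= mul1mx. Qed.

Lemma GL_mulr1 : right_id GL_one GL_mul.
Proof. by move=> g; apply: GLmx_inj; rewrite /GLmx /= mulmx1. Qed.

Lemma GL_mulV : left_inverse GL_one GL_inv GL_mul.
Proof.
by case=> [[A B] AB]; apply: GLmx_inj; case/andP: (AB) => _ /eqP.
Qed.

Lemma GL_mulrV : right_inverse GL_one GL_inv GL_mul.
Proof.
by case=> [[A B] AB]; apply: GLmx_inj; case/andP: (AB) => /eqP.
Qed.

HB.instance Definition _ :=
  isGroup.Build GL GL_mulA GL_mul1 GL_mulr1 GL_mulV GL_mulrV.

Definition transvection_mx i j x : 'M[R]_n := 1%:M + x *: delta_mx i j.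

Lemma transvection_mxM i j x y : i != j ->
  transvection_mx i j x *m transvection_mx i j y = transvection_mx i j (x + y).
Proof.
move=> ij; have ji : (j == i) = false by rewrite eq_sym (negbTE ij).
rewrite /transvection_mx mulmxDl mul1mx mulmxDr mulmx1 -scalemxAl.
suff -> : delta_mx i j *m (y *: delta_mx i j) = 0 :> 'M[R]_n.
  by rewrite scaler0 addr0 scalerDl addrA addrAC.
apply/matrixP=> p q; rewrite !mxE big1 // => s _; rewrite !mxE.
by case: (s =P j) => [->|]; rewrite ?ji /= ?andbF ?mulr0 ?mul0r.
Qed.

Lemma transvection_subproof i j (ij : i != j) x :
  mutual_inverse (transvection_mx i j x, transvection_mx i j (- x)).
Proof.
apply/andP; rewrite /= !transvection_mxM // subrr addNr.
by rewrite /transvection_mx scale0r addr0.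
Qed.

Definition transvection i j (ij : i != j) x : GL :=
  MkGL (transvection_subproof ij x).

End GeneralLinear.

Inductive subgroup_generated (G : groupType) (S : G -> Prop) : G -> Prop :=
| generated_mem g : S g -> subgroup_generated S g
| generated_one : subgroup_generated S 1%g
| generated_mul g h : subgroup_generated S g -> subgroup_generated S h ->
    subgroup_generated S (g * h)%g
| generated_inv g : subgroup_generated S g -> subgroup_generated S (g^-1)%g.

Definition elementary_group (R : nzRingType) (n : nat) : GL R n -> Prop :=
  subgroup_generated (fun g =>
    exists (i j : 'I_n) (ij : i != j) (x : R), g = transvection ij x).

(* [s ^ xi] is the library's conjugate [xi^-1 * (s * xi)]. *)
Definition elementary_conjugate (R : nzRingType) (n : nat)
    (sigma g : GL R n) : Prop :=
  exists2 xi : GL R n, elementary_group xi &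
    g = (sigma ^ xi)%g \/ g = (sigma^-1 ^ xi)%g.

Definition product_of_conjugates (R : nzRingType) (n m : nat)
    (sigma g : GL R n) : Prop :=
  exists2 f : 'I_m -> GL R n, (forall p, elementary_conjugate sigma (f p)) &
    g = (\prod_(p < m) f p)%g.

(* Main.v *)
Require Import Defs.
From mathcomp Require Import all_boot all_algebra.

(** Let [s] be the entry of sigma at [(i, j)] and choose [y] with
    [s * y * s = s].  The idempotent [e := y * s] satisfies [s = s * e], so it is
    enough to obtain the transvections with parameter [x * e * z].

    Let [d] be the [(j, j)] entry of sigma.  Conjugating sigma by [t_ji(d * y)]
    replaces [d] by [d - d * y * s] ([conj_transvection_diag]), whose product with
    [e] vanishes.  So assume [d * e = 0], and let [p], [j], [r] be distinct, which
    is where [n >= 3] is needed.  Three nested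
    commutators, each doubling the number of conjugates
    ([product_of_conjugatesR]), now suffice ([transvection_of_diag_annihilator]):
    - for [tau = t_jr(e)], the matrix [xi = sigma tau sigma^-1] has a trivial row
      [j], and [zeta = xi tau^-1] is a product of 2 conjugates;
    - the commutator of zeta with a transvection [t] at [(p, j)] is, up to
      conjugation by tau, of the form [A * t_pr(x * e)].  The factor [A] is [t]
      conjugated by [xi], times a transvection at [(p, j)]; since row [j] of [xi]
      is trivial, [A] differs from the identity in column [j] only;
    - [t_rj(z)] also differs from the identity in column [j] only, so it commutes
      with [A], and its commutator with [A * t_pr(x * e)] is [t_pj(x * e * z)].

    All transvections with the same parameter are conjugate under the elementary
    group ([transvection_conj_index]), which gives part (i).

    For part (ii), conjugating sigma by [t_ji(-c)] adds to the [(j, i)] entry the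
    wanted difference, up to [c * s * c] ([conj_transvection_offdiag]).  The
    difference is thus a sum of three terms to which part (i) applies, at a cost of
    8 conjugates each. *)

Set Implicit Arguments.
Unset Strict Implicit.
Unset Printing Implicit Defensive.

Import GRing.Theory.
Local Open Scope ring_scope.

(** * Transvections and the Steinberg relations *)

Section Transvections.

Variables (R : nzRingType) (n : nat).
Implicit Types (A : 'M[R]_n) (g h : GL R n) (i j k l p r : 'I_n) (x y z : R).

Lemma delta_mx_sandwich i j k l A x :
  delta_mx i j *m A *m (x *: delta_mx k l) = (A j k * x) *: delta_mx i l.
Proof.
apply/matrixP=> p q; rewrite !mxE (bigD1 k) //= big1 => [|s /negbTE sk].
  rewrite !mxE (bigD1 j) //= big1 => [|t /negbTE tj].
    rewrite !mxE !eqxx !addr0 andbT.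
    by case: (p == i); case: (q == l); rewrite ?mul1r ?mul0r ?mulr1 ?mulr0.
  by rewrite !mxE tj andbF mul0r.
by rewrite [X in _ * X]mxE [X in _ * (_ * X)]mxE sk /= !mulr0.
Qed.

Lemma delta_mxZ_mul i j k l x y :
  (x *: delta_mx i j) *m (y *: delta_mx k l)
    = (if j == k then x * y else 0) *: delta_mx i l :> 'M[R]_n.
Proof.
rewrite -scalemxAl -[X in X *m _]mulmx1 delta_mx_sandwich mxE scalerA.
by case: (j == k); rewrite ?mul1r // !(mul0r, mulr0).
Qed.

Lemma GLmxM g h : GLmx (g * h)%g = GLmx g *m GLmx h.
Proof. by []. Qed.

Lemma GLmxK g : GLmx (g^-1)%g *m GLmx g = 1%:M.
Proof. by rewrite -GLmxM mulVg. Qed.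

Lemma transvectionD i j (ij : i != j) x y :
  (transvection ij x * transvection ij y)%g = transvection ij (x + y).
Proof. by apply: GLmx_inj; apply: transvection_mxM. Qed.

Lemma transvectionV i j (ij : i != j) x :
  (transvection ij x)^-1%g = transvection ij (- x).
Proof. exact: GLmx_inj. Qed.

Lemma elementary_transvection i j (ij : i != j) x :
  elementary_group (transvection ij x).
Proof. by apply: generated_mem; exists i, j, ij, x. Qed.

Lemma transvection_conjr p j r (pj : p != j) (jr : j != r) (pr : p != r) x y :
  (transvection pj x ^ transvection jr y)%g
    = (transvection pj x * transvection pr (x * y))%g.
Proof.
apply: (mulgI (transvection jr y)); rewrite -conjgC; apply: GLmx_inj.
rewrite !GLmxM /GLmx /= /transvection_mx.
have [rp jp] : (r == p) = false /\ (j == p) = false.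
  by rewrite !(eq_sym _ p); split; apply: negbTE.
rewrite !(mulmxDl, mulmxDr, mul1mx, mulmx1) !delta_mxZ_mul eqxx rp jp !scale0r.
by rewrite !addr0 -!addrA; congr (_ + _); rewrite addrC -addrA addrCA.
Qed.

Lemma transvection_conjl k p r (kp : k != p) (pr : p != r) (kr : k != r) x y :
  (transvection pr x ^ transvection kp y)%g
    = (transvection pr x * transvection kr (- (y * x)))%g.
Proof.
apply: (mulgI (transvection kp y)); rewrite -conjgC; apply: GLmx_inj.
rewrite !GLmxM /GLmx /= /transvection_mx.
have [rk pk] : (r == k) = false /\ (p == k) = false.
  by rewrite !(eq_sym _ k); split; apply: negbTE.
rewrite !(mulmxDl, mulmxDr, mul1mx, mulmx1) !delta_mxZ_mul eqxx rk pk !scale0r.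
rewrite mulr0 scale0r !addr0 scaleNr.
by rewrite [X in _ = _ + X]addrC addrA [X in _ = X + _]addrAC subrK addrAC.
Qed.

Lemma commute_transvection i j k l (ij : i != j) (kl : k != l) x y :
  j != k -> l != i -> commute (transvection ij x) (transvection kl y).
Proof.
move=> /negbTE jk /negbTE li; apply: GLmx_inj.
rewrite !GLmxM /GLmx /= /transvection_mx.
rewrite !(mulmxDl, mulmxDr, mul1mx, mulmx1) !delta_mxZ_mul jk li !scale0r !addr0.
exact: addrAC.
Qed.

(** Conjugation by [g] multiplies the row vector [e_q] of the transvection by [g]
    on the right; the chosen [g] sends it to [e_q + e_q'] and then to [e_q'],
    while its inverse fixes the column vector [e_p].  Unlike a monomial matrix
    with three elementary factors, it introduces no sign. *)
Lemma transvection_move_col p q q' (pq : p != q) (pq' : p != q') x : q != q' ->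
  exists2 xi : GL R n, elementary_group xi &
    (transvection pq x ^ xi = transvection pq' x)%g.
Proof.
move=> qq'; have q'q : q' != q by rewrite eq_sym.
have qp : q != p by rewrite eq_sym.
exists (transvection qq' 1 * transvection q'q (-1))%g.
  by apply: generated_mul; apply: elementary_transvection.
rewrite conjgM transvection_conjr mulr1 conjMg transvection_conjr mulrN1.
have fixq : (transvection pq x ^ transvection q'q (-1) = transvection pq x)%g.
  by apply/conjg_fixP/commgP/commute_transvection; rewrite // eq_sym.
rewrite fixq (commute_transvection pq' pq) //; last by rewrite eq_sym.
by rewrite -transvectionV mulVKg.
Qed.

Lemma transvection_move_row p p' q (pq : p != q) (p'q : p' != q) x : p != p' ->
  exists2 xi : GL R n, elementary_group xi &
    (transvection pq x ^ xi = transvection p'q x)%g.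
Proof.
move=> pp'; have p'p : p' != p by rewrite eq_sym.
exists (transvection p'p (-1) * transvection pp' 1)%g.
  by apply: generated_mul; apply: elementary_transvection.
rewrite conjgM transvection_conjl mulN1r opprK conjMg transvection_conjl mul1r.
have fixp : (transvection pq x ^ transvection pp' 1 = transvection pq x)%g.
  by apply/conjg_fixP/commgP/commute_transvection; rewrite // eq_sym.
rewrite fixp (commute_transvection p'q pq) //; try by rewrite eq_sym.
by rewrite -transvectionV mulVKg.
Qed.

Lemma exists_third_index : (3 <= n)%N ->
  forall p q : 'I_n, exists r, (r != p) && (r != q).
Proof.
move=> n3 p q; apply/existsP; apply: contraTT n3 => /existsPn pq.
rewrite -ltnNge -[n]card_ord -cardsT ltnS.
apply: leq_trans (subset_leq_card _) (_ : (#|[set p; q]| <= 2)%N).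
  by apply/subsetP=> r _; have:= pq r; rewrite !inE negb_and !negbK.
by rewrite cards2; case: (p != q).
Qed.

Lemma transvection_conj_index_neq (p q k l : 'I_n)
    (pq : p != q) (kl : k != l) (x : R) : k != q ->
  exists2 xi : GL R n, elementary_group xi &
    (transvection pq x ^ xi = transvection kl x)%g.
Proof.
move=> kq.
have [xi Exi xiE] : exists2 xi : GL R n, elementary_group xi &
    (transvection pq x ^ xi = transvection kq x)%g.
  have [pk|] := eqVneq p k; last exact: transvection_move_row.
  exists 1%g; first exact: generated_one.
  by subst k; rewrite conjg1 (bool_irrelevance kq pq).
have [eta Eeta etaE] : exists2 eta : GL R n, elementary_group eta &
    (transvection kq x ^ eta = transvection kl x)%g.
  have [ql|] := eqVneq q l; last exact: transvection_move_col.
  exists 1%g; first exact: generated_one.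
  by subst l; rewrite conjg1 (bool_irrelevance kl kq).
exists (xi * eta)%g; first exact: generated_mul.
by rewrite conjgM xiE.
Qed.

(** The direct route, changing the row index and then the column index, passes
    through position [(k, q)], which is diagonal when [k = q]; moving the column
    index to a third value first avoids this. *)
Lemma transvection_conj_index (n3 : (3 <= n)%N) (p q k l : 'I_n)
    (pq : p != q) (kl : k != l) (x : R) :
  exists2 xi : GL R n, elementary_group xi &
    (transvection pq x ^ xi = transvection kl x)%g.
Proof.
have [kq|] := eqVneq k q; last exact: transvection_conj_index_neq.
have [r /andP[rp rq]] := exists_third_index n3 p q.
have pr : p != r by rewrite eq_sym.
have [xi Exi xiE] := transvection_conj_index_neq pq pr x pq.
have kr : k != r by rewrite kq eq_sym.
have [eta Eeta etaE] := transvection_conj_index_neq pr kl x kr.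
exists (xi * eta)%g; first exact: generated_mul.
by rewrite conjgM xiE.
Qed.

(** When row [j] of [g] is trivial, [g^-1 e_p] has no [j]-th coordinate and
    [e_j g = e_j] as a row vector.  Hence the conjugate is again the identity plus
    a matrix supported on column [j] off the diagonal, and such elements form an
    abelian group. *)
Lemma commute_conj_transvection g p j r (pj : p != j) (rj : r != j) x z :
    delta_mx j j *m g = delta_mx j j ->
  commute (transvection pj x ^ g)%g (transvection rj z).
Proof.
move=> gj; have gVj : delta_mx j j *m GLmx (g^-1)%g = delta_mx j j.
  by rewrite -{1}gj -mulmxA -GLmxM mulgV mulmx1.
(* Only row [j] of [A] matters in this product. *)
have deltaZ i y A :
    y *: delta_mx i j *m A = y *: delta_mx i j *m (delta_mx j j *m A).
  by rewrite mulmxA -(scalemxAl _ _ (delta_mx j j)) mul_delta_mx.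
have -> : (transvection pj x ^ g)%g = (g^-1 * transvection pj x * g)%g.
  by rewrite conjgE mulgA.
set t := transvection rj z.
have [jp jr] : (j == p) = false /\ (j == r) = false.
  by rewrite !(eq_sym j); split; apply: negbTE.
set N := GLmx (g^-1)%g *m (x *: delta_mx p j).
have gE : GLmx (g^-1 * transvection pj x * g)%g = 1%:M + N.
  rewrite !GLmxM [GLmx (transvection _ _)]/GLmx /= /transvection_mx.
  rewrite mulmxDr mulmxDl mulmx1 GLmxK; congr (_ + _).
  by rewrite -mulmxA deltaZ gj -scalemxAl mul_delta_mx.
apply: GLmx_inj; rewrite [LHS]GLmxM [RHS]GLmxM gE.
rewrite [GLmx t]/GLmx /= /transvection_mx.
rewrite !(mulmxDl, mulmxDr, mul1mx, mulmx1) -mulmxA delta_mxZ_mul jr.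
rewrite scale0r mulmx0.
rewrite [X in _ = _ + (_ + X)](_ : _ = 0); first by rewrite !addr0 addrAC.
rewrite deltaZ (mulmxA (delta_mx j j)) gVj -[X in X *m (x *: _)]scale1r.
by rewrite delta_mxZ_mul jp scale0r mulmx0.
Qed.

(** Row [j] of [sigma (1 + e e^jr)] is row [j] of sigma, because the only
    correction is the [(j, j)] entry times [e]. *)
Lemma fixed_row_conj_transvection (sigma : GL R n) j r (jr : j != r) e :
    sigma j j * e = 0 ->
  delta_mx j j *m GLmx (transvection jr e ^ sigma^-1)%g = delta_mx j j.
Proof.
move=> se0; rewrite conjgE invgK !GLmxM.
rewrite [GLmx (transvection _ _)]/GLmx /= /transvection_mx.
rewrite mulmxDl mul1mx mulmxDr -GLmxM mulgV mulmxDr mulmx1 !mulmxA.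
by rewrite delta_mx_sandwich se0 scale0r mul0mx addr0.
Qed.

Lemma mul_transvection_mx i j x A k l :
  (transvection_mx i j x *m A) k l = A k l + (if k == i then x * A j l else 0).
Proof.
rewrite mulmxDl mul1mx mxE; congr (_ + _).
rewrite -scalemxAl !mxE (bigD1 j) //= big1 => [|s /negbTE sj].
  by rewrite mxE eqxx andbT addr0; case: (k == i); rewrite ?mul1r // mul0r mulr0.
by rewrite mxE sj andbF mul0r.
Qed.

Lemma mulmx_transvection i j x A k l :
  (A *m transvection_mx i j x) k l = A k l + (if l == j then A k i * x else 0).
Proof.
rewrite mulmxDr mulmx1 mxE; congr (_ + _).
rewrite !mxE (bigD1 i) //= big1 => [|s /negbTE si].
  by rewrite !mxE eqxx addr0; case: (l == j); rewrite ?mulr1 // !mulr0.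
by rewrite !mxE si !mulr0.
Qed.

Lemma conj_transvection_diag (sigma : GL R n) i j (ji : j != i) c :
  (sigma ^ transvection ji c)%g j j = sigma j j - c * sigma i j.
Proof.
rewrite conjgE transvectionV !GLmxM mul_transvection_mx !mulmx_transvection.
by rewrite eqxx (negbTE ji) !addr0 mulNr.
Qed.

Lemma conj_transvection_offdiag (sigma : GL R n) i j (ji : j != i) c :
  (sigma ^ transvection ji c)%g j i
    = sigma j i + sigma j j * c - c * sigma i i - c * sigma i j * c.
Proof.
rewrite conjgE transvectionV !GLmxM mul_transvection_mx !mulmx_transvection.
by rewrite !eqxx mulNr mulrDr opprD addrA mulrA.
Qed.

End Transvections.

(** * Products of elementary conjugates *)

Section ProductsOfConjugates.

Variables (R : nzRingType) (n : nat).
Implicit Types (sigma g h xi : GL R n).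

Lemma product_of_conjugates1 sigma g :
  elementary_conjugate sigma g -> product_of_conjugates 1 sigma g.
Proof. by move=> sg; exists (fun=> g) => //; rewrite big_ord1. Qed.

Lemma product_of_conjugatesM m1 m2 sigma g h :
    product_of_conjugates m1 sigma g -> product_of_conjugates m2 sigma h ->
  product_of_conjugates (m1 + m2) sigma (g * h)%g.
Proof.
case=> f1 f1P -> [f2 f2P ->].
exists (fun p => match split p with inl a => f1 a | inr b => f2 b end).
  by move=> p; case: (split p).
rewrite big_split_ord /=; congr (_ * _)%g; apply: eq_bigr => p _.
  by rewrite -[lshift _ _]/(unsplit (inl p)) unsplitK.
by rewrite -[rshift _ _]/(unsplit (inr p)) unsplitK.
Qed.

Lemma product_of_conjugatesV m sigma g :
  product_of_conjugates m sigma g -> product_of_conjugates m sigma (g^-1)%g.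
Proof.
case=> f fP ->; elim: m f fP => [|m IHm] f fP.
  by exists f => //; rewrite !big_ord0 invg1.
rewrite big_ord_recr invgM; apply: (@product_of_conjugatesM 1 m); last exact: IHm.
apply: product_of_conjugates1; have [xi Exi [] ->] := fP ord_max; exists xi => //.
  by right; rewrite conjVg.
by left; rewrite conjVg invgK.
Qed.

Lemma product_of_conjugatesJ m sigma g xi :
    elementary_group xi -> product_of_conjugates m sigma g ->
  product_of_conjugates m sigma (g ^ xi)%g.
Proof.
move=> Exi [f fP ->]; exists (fun p => f p ^ xi)%g; last exact: conjg_prod.
move=> p; have [eta Eeta fE] := fP p; exists (eta * xi)%g; first exact: generated_mul.
by rewrite !conjgM; case: fE => ->; [left | right].
Qed.

Lemma product_of_conjugates_of_conj m sigma g xi :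
    elementary_group xi -> product_of_conjugates m (sigma ^ xi)%g g ->
  product_of_conjugates m sigma g.
Proof.
move=> Exi [f fP ->]; exists f => // p.
have [eta Eeta fE] := fP p; exists (xi * eta)%g; first exact: generated_mul.
by rewrite !conjgM conjVg.
Qed.

Lemma product_of_conjugatesR m sigma g xi :
    elementary_group xi -> product_of_conjugates m sigma g ->
  product_of_conjugates (m + m) sigma [~ g, xi]%g.
Proof.
move=> Exi sg; rewrite commgEl; apply: product_of_conjugatesM.
  exact: product_of_conjugatesV.
exact: product_of_conjugatesJ.
Qed.

(** The hypothesis says that row [j] of sigma kills the column vector [e_j e], so
    the transvection at [(j, r)] with parameter [e], conjugated by the inverse of
    sigma, has a trivial row [j].  From there three commutators give the factor
    [8 = 2 ^ 3]: the first makes that conjugate a factor of [zeta], the second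
    brings [e] out at [(p, r)], and the third removes everything else. *)
Lemma transvection_of_diag_annihilator sigma p j r (pj : p != j) (jr : j != r)
    (pr : p != r) (x e z : R) :
    sigma j j * e = 0 ->
  product_of_conjugates 8 sigma (transvection pj (x * e * z)).
Proof.
move=> se0; have rj : r != j by rewrite eq_sym.
(* The inverse of [t] is what ends up conjugated by tau, hence the sign. *)
set tau := transvection jr e; set t := transvection pj (- x).
have Etau : elementary_group tau by apply: elementary_transvection.
set xi := (tau ^ sigma^-1)%g.
pose zeta := [~ sigma^-1, tau^-1]%g.
have zetaP : product_of_conjugates 2 sigma zeta.
  apply: (@product_of_conjugatesR 1); first exact: generated_inv.
  apply: product_of_conjugates1; exists 1%g; first exact: generated_one.
  by right; rewrite conjg1.
have etaP : product_of_conjugates 4 sigma ([~ zeta, t^-1] ^ tau)%g.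
  apply: product_of_conjugatesJ => //.
  apply: (@product_of_conjugatesR 2) => //.
  exact/generated_inv/elementary_transvection.
have etaE : ([~ zeta, t^-1] ^ tau = t ^ xi * (t^-1) ^ tau)%g.
  rewrite /zeta /xi !commgEl !conjgE !invgM !invgK !mulgA.
  by rewrite !(mulgK, mulgVK, mulVg, mul1g).
pose B := transvection pr (x * e).
pose A := (t ^ xi * transvection pj x)%g.
(* Conjugation by tau multiplies the row vector [e_j] by tau, which gives
   [e_j + e e_r]: this is where the parameter [x * e] comes from. *)
have {}etaE : ([~ zeta, t^-1] ^ tau = A * B)%g.
  by rewrite etaE transvectionV opprK transvection_conjr mulgA.
pose d := transvection rj z.
have cAd : commute A d.
  apply/commute_sym/commuteM; apply/commute_sym.
    exact/commute_conj_transvection/fixed_row_conj_transvection.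
  by apply: commute_transvection; rewrite // eq_sym.
have dE : ([~ A * B, d] = transvection pj (x * e * z))%g.
  rewrite commgEl conjMg (conjg_fixP _); last exact/commgP.
  rewrite (transvection_conjr pr rj pj).
  by rewrite -/B (mulgA A) mulKg.
rewrite -dE; apply: (@product_of_conjugatesR 4); last by rewrite -etaE.
exact: elementary_transvection.
Qed.

End ProductsOfConjugates.

(** * The theorem *)

(** Write [s] and [d] for the entries at [(i, j)] and [(j, j)].  After conjugation
    [d] becomes [d - d * y * s], and [(d - d * y * s) * (y * s) = 0] because
    [s * y * s = s].  The transvections obtained from [e := y * s] include the
    required one, since [s = s * (y * s)]. *)
Theorem entry_product_of_conjugates (n : nat) (hn : (3 <= n)%N)
    (R : nzRingType) (hR : von_neumann_regular R) (sigma : GL R n)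
    (i j k l : 'I_n) (hij : i != j) (hkl : k != l) (a b : R) :
  product_of_conjugates 8 sigma (transvection hkl (a * sigma i j * b)).
Proof.
have [y sys] := hR (sigma i j).
have ji : j != i by rewrite eq_sym.
pose c := sigma j j * y.
apply: (@product_of_conjugates_of_conj _ _ _ _ _ (transvection ji c)).
  exact: elementary_transvection.
have jje : (sigma ^ transvection ji c)%g j j * (y * sigma i j) = 0.
  rewrite conj_transvection_diag mulrBl /c -!mulrA (mulrA (sigma i j) y) sys.
  by rewrite subrr.
have [p /andP[pj pi]] := exists_third_index hn j i.
have [xi Exi <-] := transvection_conj_index hn pj hkl (a * sigma i j * b).
apply: product_of_conjugatesJ => //.
have -> : a * sigma i j * b = a * sigma i j * (y * sigma i j) * b.
  by rewrite -[LHS]mulrA -{1}sys !mulrA.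
exact: transvection_of_diag_annihilator ji pi _ _ _ jje.
Qed.

Theorem theorem15 (n : nat) (hn : (3 <= n)%N)
    (R : nzRingType) (hR : von_neumann_regular R) (sigma : GL R n)
    (i j k l : 'I_n) (hij : i != j) (hkl : k != l) (a b c : R) :
  product_of_conjugates 8 sigma (transvection hkl (a * sigma i j * b)) /\
  product_of_conjugates 24 sigma
    (transvection hkl (a * (c * sigma i i - sigma j j * c) * b)).
Proof.
split; first exact: entry_product_of_conjugates.
have ji : j != i by rewrite eq_sym.
set X := _ - _.
have XE : X = (sigma ^ transvection ji (- c))%g j i - sigma j i
    + c * sigma i j * c.
  rewrite conj_transvection_offdiag !mulNr !mulrN !opprK.
  rewrite [X in _ = X + _]addrAC subrK.
  by rewrite [_ - sigma j j * c]addrC addrAC addrK addrC.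
have -> : a * X * b = a * (sigma ^ transvection ji (- c))%g j i * b
    + - a * sigma j i * b + (a * c) * sigma i j * (c * b).
  by rewrite XE mulrDr mulrBr !mulrDl !mulNr !mulrA.
rewrite -!transvectionD.
apply: (@product_of_conjugatesM _ _ 16 8); last first.
  exact: entry_product_of_conjugates.
apply: (@product_of_conjugatesM _ _ 8 8); last first.
  exact: entry_product_of_conjugates.
apply: (product_of_conjugates_of_conj (elementary_transvection ji (- c))).
exact: entry_product_of_conjugates.
Qed.
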